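(* Let $a\ge 1$ and $m\ge 0$ be integers. Let $f_0$ be defined by $f_0(1)=1$, $f_0(2)=0$, and $f_0(n+2)=af_0(n)$ for $n\ge 1$, and let $f_m$ be the $m$-th invert transform of $f_0$. Then for every $n\ge 1$, the number $f_m(n)$ is the number of words of length $n-1$ over the alphabet $\{0,1,\ldots,a-1,\ldots,a+m-1\}$ such that the letters $0,1,\ldots,a-1$ avoid runs of odd length.
   Context: For an arithmetic function $f_0$ defined on the positive integers, the functions $f_m$ ($m\ge 1$) are defined recursively by $f_m(n)=\sum_{k=1}^n\ \sum_{i_1+\cdots+i_k=n} f_{m-1}(i_1)\cdots f_{m-1}(i_k)$, where the inner sum is over positive integers $i_1,\ldots,i_k$. A run is a maximal block of consecutive equal letters; the condition says that every run of a letter from $\{0,\ldots,a-1\}$ has even length. *)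

(* Defs.v *)
From mathcomp Require Import all_boot.

Set Implicit Arguments.
Unset Strict Implicit.
Unset Printing Implicit Defensive.

(* Arithmetic functions on the positive integers are represented as functions
   nat -> nat; their value at 0 is never used. The parts i j of a composition
   of n are at most n, so it loses nothing to let them range over 'I_n.+1. *)
Definition invert (f : nat -> nat) (n : nat) : nat :=
  \sum_(1 <= k < n.+1)
    \sum_(i : {ffun 'I_k -> 'I_n.+1} |
            [forall j, 0 < i j] && (\sum_(j < k) i j == n))
      \prod_(j < k) f (i j).

Definition invert_iter (m : nat) (f0 : nat -> nat) : nat -> nat :=
  iter m invert f0.

Section Runs.
Variable T : eqType.
Implicit Type w : seq T.

(* The letters of w at positions i, ..., j - 1 (positions start at 0). *)
Definition block w (i j : nat) : seq T := take (j - i) (drop i w).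

Definition equal_block w (i j : nat) : bool :=
  [&& i < j, j <= size w & constant (block w i j)].

Definition is_run w (i j : nat) : bool :=
  equal_block w i j &&
  [forall i' : 'I_(size w).+1, forall j' : 'I_(size w).+1,
     [&& i' <= i, j <= j' & equal_block w i' j'] ==> (i' == i :> nat) && (j' == j :> nat)].

Definition avoid_odd_runs (P : pred T) w : bool :=
  [forall i : 'I_(size w).+1, forall j : 'I_(size w).+1,
     is_run w i j && all P (block w i j) ==> ~~ odd (j - i)].

End Runs.

(* Main.v *)
Require Import Defs.
From mathcomp Require Import all_boot.
From mathcomp Require Import ssralg poly.
From mathcomp Require Import zify ring.

Set Implicit Arguments.
Unset Strict Implicit.
Unset Printing Implicit Defensive.

(** Both sides satisfy the linear recurrence
      F 1 = 1,  F 2 = m,  F (n + 2) = m F (n + 1) + a F n.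

    On the side of words: if every run of a letter satisfying P has even length,
    such a run can be cut into pairs of equal letters, and conversely. Hence
    the admissible words are exactly the products of blocks x, with x outside P,
    and cc, with c in P (avoid_odd_runsE), and this factorisation is unique, as
    it can be read off from left to right. Removing the first block gives the
    recurrence, with m blocks of length 1 and a blocks of length 2
    (doubled_countSS).

    On the side of transforms: in terms of generating functions, the recurrence
    says F = X / (1 - m X - a X^2), and the invert transform F / (1 - F) is then
    X / (1 - (m + 1) X - a X^2); it thus replaces m by m + 1 (invert_lin_rec).
    Since f0 satisfies the recurrence with m = 0, its m-th transform satisfies
    it with m. The proof avoids power series: it applies the recurrence
      F^(k+1) = X F^k + m X F^(k+1) + a X^2 F^(k+1)
    to the coefficients of the powers of F (comp_sum_rec) and sums over k. That
    the composition sums in the definition of the transform are these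
    coefficients is the expansion of a power of a polynomial that agrees with F
    up to the relevant degree (sum_compositions). *)

(** * Words whose runs in P are even *)

Section RunsOfWords.
Variable T : eqType.
Implicit Types (w v : seq T) (x : T) (P : pred T).

Lemma equal_blockP x0 w i j :
  reflect [/\ i < j, j <= size w &
             forall p, i <= p < j -> nth x0 w p = nth x0 w i]
          (equal_block w i j).
Proof.
rewrite /equal_block /block; case: (ltnP i j) => [ij|ji] /=; last first.
  by apply: ReflectF; case; lia.
case: (leqP j (size w)) => [js|sj] /=; last first.
  by apply: ReflectF; case; lia.
have sz : size (take (j - i) (drop i w)) = j - i.
  by rewrite size_takel // size_drop leq_sub2r.
have nE p : p < j - i -> nth x0 (take (j - i) (drop i w)) p = nth x0 w (i + p).
  by move=> pj; rewrite nth_take // nth_drop.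
apply: (iffP (constantP x0 _)).
  case=> y wE; split=> // p /andP[ip pj].
  have lt q : q < j - i -> nth x0 w (i + q) = y.
    by move=> qj; rewrite -nE // wE nth_nseq sz qj.
  by rewrite -(subnKC ip) lt ?ltn_sub2r // -[in RHS](addn0 i) lt ?subn_gt0.
case=> _ _ H; exists (nth x0 w i); apply: (@eq_from_nth _ x0) => [|p].
  by rewrite size_nseq.
rewrite sz => pj; rewrite nE // nth_nseq pj H // leq_addr /=; lia.
Qed.

Lemma is_runP w i j :
  reflect (equal_block w i j /\
           forall i' j', i' <= i -> j <= j' -> equal_block w i' j' ->
             i' = i /\ j' = j)
          (is_run w i j).
Proof.
apply: (iffP andP) => -[eb maxi]; split=> //.
  move=> i' j' ii' jj' eb'; have /and3P[ij' js _] := eb'.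
  have i's : i' < (size w).+1 by rewrite ltnS ltnW // (leq_trans ij').
  have j's : j' < (size w).+1 by [].
  have /forallP/(_ (Ordinal i's))/forallP/(_ (Ordinal j's)) /= := maxi.
  by rewrite ii' jj' eb' /= => /andP[/eqP-> /eqP->].
apply/forallP=> i'; apply/forallP=> j'; apply/implyP=> /and3P[ii jj eb'].
by have [-> ->] := maxi _ _ ii jj eb'; rewrite !eqxx.
Qed.

Lemma avoid_odd_runsP P w :
  reflect (forall i j, is_run w i j -> all P (block w i j) -> ~~ odd (j - i))
          (avoid_odd_runs P w).
Proof.
apply: (iffP idP) => [/forallP H i j runw aP | H].
  have /andP[/and3P[ij js _] _] := runw.
  have i_s : i < (size w).+1 by rewrite ltnS ltnW // (leq_trans ij).
  have j_s : j < (size w).+1 by [].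
  have /forallP/(_ (Ordinal j_s)) /= := H (Ordinal i_s).
  by rewrite runw aP.
apply/forallP=> i; apply/forallP=> j; apply/implyP=> /andP[]; exact: H.
Qed.

(** Runs can be handled by induction on the word, one run at a time: the runs
    of a word are its first run and the translates of the runs of the rest. *)
Section FirstRun.
Variables (x : T) (k : nat) (v : seq T).
Hypotheses (k_gt0 : 0 < k) (hv : ohead v != Some x).
Let w := nseq k x ++ v.

Let nth_w p : nth x w p = if p < k then x else nth x v (p - k).
Proof.
by rewrite /w nth_cat size_nseq nth_nseq; case: (p < k).
Qed.

Let size_w : size w = k + size v. Proof. by rewrite size_cat size_nseq. Qed.

Lemma equal_block_first i j : i < j -> j <= k -> equal_block w i j.
Proof.
move=> ij jk; apply/(equal_blockP x); split=> // [|p /andP[ip pj]].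
  by rewrite size_w; lia.
by rewrite !nth_w !ifT //; lia.
Qed.

Lemma equal_block_shift i j :
  equal_block w (k + i) (k + j) = equal_block v i j.
Proof.
rewrite /equal_block /block ltn_add2l size_w leq_add2l subnDl.
by rewrite (addnC k i) -drop_drop drop_size_cat ?size_nseq.
Qed.

(** The position k carries a letter other than x, so a constant block cannot
    contain both it and a position before it. *)
Lemma equal_block_no_straddle i j : equal_block w i j -> (j <= k) || (k <= i).
Proof.
move/(equal_blockP x) => [ij js H]; case: (leqP j k) => //= kj.
case: (leqP k i) => // ik.
have := H k; rewrite !nth_w ltnn ik subnn kj (ltnW ik) => /(_ isT).
move: hv js; rewrite size_w; case: (v) => [|y v'] /=; first by lia.
by move=> ne _ yx; rewrite yx eqxx in ne.
Qed.

Lemma is_run_first : is_run w 0 k.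
Proof.
apply/is_runP; split=> [|i' j' i0 jk eb]; first exact: equal_block_first.
have := equal_block_no_straddle eb; lia.
Qed.

Lemma is_run_firstP i j : is_run w i j -> j <= k -> i = 0 /\ j = k.
Proof.
move=> /is_runP[eb maxi] jk.
by have [] := maxi 0 k (leq0n _) jk (equal_block_first k_gt0 (leqnn k)).
Qed.

(** No constant block straddles the end of the first run, so an extension of a
    block of v inside w still lies in v, and maximality is the same in both. *)
Lemma is_run_shift i j : is_run w (k + i) (k + j) = is_run v i j.
Proof.
apply/is_runP/is_runP => -[]; rewrite equal_block_shift => eb maxi; split=> //.
  move=> i' j' ii jj eb'; have := maxi (k + i') (k + j').
  by rewrite equal_block_shift !leq_add2l => /(_ ii jj eb'); lia.
move=> i' j' ii jj eb'; have /and3P[ij _ _] := eb.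
have ki' : k <= i' by have := equal_block_no_straddle eb'; lia.
have kj' : k <= j' by lia.
have := maxi (i' - k) (j' - k).
rewrite -equal_block_shift !subnKC // => /(_ _ _ eb'); lia.
Qed.

Lemma block_shift i j : block w (k + i) (k + j) = block v i j.
Proof.
by rewrite /block subnDl (addnC k i) -drop_drop drop_size_cat ?size_nseq.
Qed.

Lemma block_first : block w 0 k = nseq k x.
Proof. by rewrite /block subn0 drop0 take_size_cat ?size_nseq. Qed.

Lemma avoid_odd_runs_first P :
  avoid_odd_runs P w = (P x ==> ~~ odd k) && avoid_odd_runs P v.
Proof.
apply/avoid_odd_runsP/andP => [H | [Hx /avoid_odd_runsP Hv] i j runw aP].
  split.
    apply/implyP=> Px; have := H _ _ is_run_first.
    by rewrite block_first subn0 all_nseq Px orbT; apply.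
  apply/avoid_odd_runsP=> i j; rewrite -is_run_shift -block_shift => runw aP.
  by rewrite -(subnDl k); apply: H.
have /andP[eb _] := runw.
have /orP[jk | ki] := equal_block_no_straddle eb.
  have [i0 jE] := is_run_firstP runw jk; move: aP.
  rewrite i0 jE block_first subn0 all_nseq; case: k k_gt0 Hx => //= k' _.
  by move/implyP.
have /and3P[ij _ _] := eb; have kj : k <= j by lia.
move: runw aP; rewrite -(subnKC ki) -(subnKC kj) is_run_shift block_shift subnDl.
exact: Hv.
Qed.

End FirstRun.

(** Deterministic left-to-right recognition of the products of blocks x, with
    x outside P, and cc, with c in P. *)
Fixpoint doubled P w : bool :=
  if w is x :: w' then
    if P x then (if w' is y :: w'' then (y == x) && doubled P w'' else false)
    else doubled P w'
  else true.

Lemma doubled_first P x k v : ohead v != Some x ->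
  doubled P (nseq k x ++ v) = (P x ==> ~~ odd k) && doubled P v.
Proof.
move=> hv; case Px: (P x) => /=; last first.
  by elim: k => //= k IH; rewrite Px.
have [n] := ubnP k; elim: n k => // n IH [|[|k]] //= kn.
  by rewrite Px; case: (v) hv => //= y v'; rewrite -[_ == Some x]/(y == x) => /negPf->.
by rewrite Px eqxx /= IH ?negbK //; lia.
Qed.

Lemma first_run x w : {k & {v | x :: w = nseq k.+1 x ++ v & ohead v != Some x}}.
Proof.
elim: w => [|y w [k [v wE hv]]]; first by exists 0, [::].
have [->|yx] := eqVneq y x; first by exists k.+1, v; rewrite //= wE.
by exists 0, (y :: w).
Qed.

(** Both predicates factor in the same way over the first run: a run of a
    letter of P is a product of pairs cc exactly when its length is even. *)
Lemma avoid_odd_runsE P w : avoid_odd_runs P w = doubled P w.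
Proof.
have [n] := ubnP (size w); elim: n w => // n IH [_|x w].
  apply/avoid_odd_runsP => i j /andP[/and3P[ij]] /=; lia.
have [k [v -> hv]] := first_run x w.
rewrite size_cat size_nseq => sn.
by rewrite avoid_odd_runs_first // doubled_first // IH //; lia.
Qed.

End RunsOfWords.

(** * Counting these words *)

Lemma sum_tupleS (T : finType) n (F : seq T -> nat) :
  \sum_(w : n.+1.-tuple T) F w = \sum_x \sum_(w : n.-tuple T) F (x :: w).
Proof.
rewrite pair_big /= (reindex (fun p : T * n.-tuple T => [tuple of p.1 :: p.2])) //=.
exists (fun w => (thead w, [tuple of behead w])) => [[x w] _|w _] /=.
  by congr pair; apply: val_inj.
by apply: val_inj; case/tupleP: w.
Qed.

Section CountDoubled.
Variables (T : finType) (P : pred T).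

Definition doubled_count n : nat := \sum_(w : n.-tuple T) doubled P w.

Lemma doubled_countE n :
  #|[set w : n.-tuple T | avoid_odd_runs P w]| = doubled_count n.
Proof.
rewrite -sum1_card big_mkcond; apply: eq_bigr => w _.
by rewrite inE avoid_odd_runsE; case: doubled.
Qed.

Lemma doubled_count0 : doubled_count 0 = 1.
Proof.
rewrite /doubled_count (eq_bigr (fun=> 1)) => [|w _]; last by rewrite tuple0.
by rewrite sum1_card card_tuple expn0.
Qed.

Lemma doubled_count1 : doubled_count 1 = #|predC P|.
Proof.
rewrite /doubled_count (sum_tupleS _ (fun w => nat_of_bool (doubled P w))) -sum1_card.
rewrite [RHS]big_mkcond; apply: eq_bigr => x _.
rewrite (eq_bigr (fun=> (~~ P x) : nat)) => [|w _]; last first.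
  by rewrite tuple0 /=; case: (P x).
by rewrite sum_nat_const card_tuple expn0 mul1n !inE; case: (P x).
Qed.

(** A word starts with a letter outside P, followed by any admissible word, or
    with two equal letters of P, followed by any admissible word. *)
Lemma doubled_countSS n :
  doubled_count n.+2 = #|predC P| * doubled_count n.+1 + #|P| * doubled_count n.
Proof.
rewrite /doubled_count (sum_tupleS _ (fun w => nat_of_bool (doubled P w))).
rewrite addnC (bigID P) /= -!sum_nat_const; congr (_ + _).
  apply: eq_bigr => x Px; rewrite (sum_tupleS _ (fun w => nat_of_bool (doubled P (x :: w)))) /=.
  rewrite (bigD1 x) //= [X in _ + X]big1 ?addn0 => [|y yx].
    by apply: eq_bigr => w _; rewrite Px eqxx.
  by apply: big1 => w _; rewrite Px (negPf yx).
by apply: eq_bigr => x Px; apply: eq_bigr => w _; rewrite (negPf Px).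
Qed.

End CountDoubled.

(** * Composition sums *)

(** The coefficient of X^n in (f 1 X + f 2 X^2 + ...)^k, computed by splitting
    off the first part i + 1 of a composition of n into k parts. *)
Fixpoint comp_sum (f : nat -> nat) k n : nat :=
  if k is k'.+1 then \sum_(i < n) f i.+1 * comp_sum f k' (n - i.+1)
  else n == 0.

Lemma comp_sum_eq0 f k n : n < k -> comp_sum f k n = 0.
Proof.
elim: k n => // k IH n nk /=; apply: big1 => i _.
by rewrite IH ?muln0 //; have := ltn_ord i; lia.
Qed.

Section CompositionPolynomial.
Import GRing.Theory.
Local Open Scope ring_scope.
Variable f : nat -> nat.

(** The coefficient at 0 is set to 0, whatever f 0 is, because the parts of a
    composition are positive. *)
Definition trunc_gen N : {poly nat} :=
  \poly_(i < N.+1) (if i is 0%N then 0 else f i).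

Lemma coef_trunc_genX N k n : (n <= N)%N ->
  (trunc_gen N ^+ k)`_n = comp_sum f k n.
Proof.
elim: k n => [|k IH] n nN; first by rewrite expr0 coef1 /=; case: eqP.
rewrite exprS coefM big_ord_recl coef_poly /= mul0r add0r.
apply: eq_bigr => i _; rewrite coef_poly IH /bump /= ?add1n.
  by rewrite ifT //; have := ltn_ord i; lia.
by lia.
Qed.

(** Expanding the k-th power of the polynomial trunc_gen f N by distributivity
    gives one monomial for each function from 'I_k to 'I_N.+1; its degree is the
    sum of the values, and its coefficient vanishes when some value is 0. *)
Lemma sum_compositions N k n : (n <= N)%N ->
  (\sum_(i : {ffun 'I_k -> 'I_N.+1} |
        [forall j, 0 < i j] && (\sum_(j < k) i j == n))
      \prod_(j < k) f (i j))%N = comp_sum f k n.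
Proof.
move=> nN; rewrite -(coef_trunc_genX k nN) /trunc_gen poly_def.
rewrite -[k in RHS]card_ord -prodr_const bigA_distr_bigA coef_sum big_mkcond /=.
apply: eq_bigr => i _.
set h := fun q : nat => if q is 0%N then 0 else f q.
have -> : \prod_j (h (i j) *: 'X^(i j)) =
    (\prod_j h (i j)) *: 'X^(\sum_j i j) :> {poly nat}.
  elim/big_ind3: _ => [|p1 c1 e1 p2 c2 e2 -> ->|//]; first by rewrite expr0 scale1r.
  by rewrite -scalerAl -scalerAr scalerA exprD.
rewrite coefZ coefXn eq_sym.
case: (boolP [forall j, _]) => [/forallP pos | /forallPn[j]] /=.
  have -> : \prod_j h (i j) = \prod_j f (i j).
    by apply: eq_bigr => j _; rewrite /h; case: (nat_of_ord (i j)) (pos j).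
  by case: eqP => _; rewrite ?mulr1 ?mulr0.
rewrite -eqn0Ngt => /eqP i0; rewrite (bigD1 j) //= {1}/h i0.
by rewrite !mul0r.
Qed.

End CompositionPolynomial.

(** A composition of n has at most n parts, so the number of parts may run up to
    any common bound M; this allows transforms at different arguments to be
    compared term by term. *)
Lemma invertE f n M : n <= M -> invert f n = \sum_(k < M) comp_sum f k.+1 n.
Proof.
move=> nM; rewrite /invert big_add1 /= big_mkord.
rewrite (eq_bigr (fun k : 'I_n => comp_sum f k.+1 n)) => [|k _]; last first.
  exact: sum_compositions.
rewrite -!(big_mkord xpredT (fun k => comp_sum f k.+1 n)).
rewrite (big_cat_nat (n := n) (p := M)) // -[LHS]addn0; congr (_ + _).
rewrite big_nat_cond big1 //.
by move=> k /andP[/andP[nk _] _]; apply: comp_sum_eq0.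
Qed.

(** * The linear recurrence *)

(** The coefficients of X / (1 - b X - a X^2). The recurrence starts at n = 1, as
    the value at 0 of an arithmetic function is arbitrary. *)
Definition lin_rec (a b : nat) (f : nat -> nat) :=
  [/\ f 1 = 1, f 2 = b & forall n, 0 < n -> f n.+2 = b * f n.+1 + a * f n].

Lemma lin_rec_unique a b f g n : lin_rec a b f -> lin_rec a b g -> 0 < n ->
  f n = g n.
Proof.
move=> [f1 f2 fS] [g1 g2 gS]; have [m] := ubnP n.
elim: m n => // m IH [//|[|[|n]]] nm _; rewrite ?f1 ?f2 //.
by rewrite fS // gS // !IH //; lia.
Qed.

(** This is F^(k+1) = X F^k + b X F^(k+1) + a X^2 F^(k+1), obtained by replacing
    the first factor F by X + b X F + a X^2 F. *)
Lemma comp_sum_rec a b f k n : lin_rec a b f ->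
  comp_sum f k.+1 n.+2 =
    comp_sum f k n.+1 + b * comp_sum f k.+1 n.+1 + a * comp_sum f k.+1 n.
Proof.
case=> f1 f2 fS; rewrite /= !big_ord_recl /= f1 !mul1n /bump /= f2 !add1n !subSS !subn0.
rewrite -!addnA mulnDr; congr (_ + _); rewrite -addnA; congr (_ + _).
rewrite !big_distrr -big_split /=; apply: eq_bigr => i _.
by rewrite !add1n fS // !subSS; ring.
Qed.

(** Summing comp_sum_rec over k, the additional term X F^k contributes the sum
    of all composition sums of n + 1 once more, which turns b into b + 1. *)
Lemma invert_lin_rec a b f : lin_rec a b f -> lin_rec a b.+1 (invert f).
Proof.
move=> rf; have [f1 f2 fS] := rf; split.
- by rewrite (@invertE _ 1 1) //= !big_ord1 /= f1.
- rewrite (@invertE _ 2 2) // !big_ord_recl !big_ord0 /=.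
  by rewrite !(big_ord_recl 1) !(big_ord_recl 0) !big_ord0 /= f1 f2; lia.
move=> n n0; rewrite !(@invertE _ _ n.+2) //; last by lia.
rewrite (eq_bigr _ (fun (k : 'I_n.+2) _ => comp_sum_rec k n rf)).
rewrite !big_split -!big_distrr /= mulSn; congr (_ + _ + _).
(* The two sums differ by their terms with 0 and with n + 2 parts; both vanish
   for compositions of n + 1. *)
have last0 : comp_sum f (ord_max : 'I_n.+2).+1 n.+1 = 0 by exact: comp_sum_eq0.
by rewrite big_ord_recl [RHS]big_ord_recr [X in _ = _ + X]last0 addn0.
Qed.

Theorem proposition6 (a m : nat) (ha : 1 <= a) (f0 : nat -> nat)
    (f0_1 : f0 1 = 1) (f0_2 : f0 2 = 0)
    (f0_rec : forall n : nat, 1 <= n -> f0 (n + 2) = a * f0 n)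
    (n : nat) (hn : 1 <= n) :
  invert_iter m f0 n =
    #|[set w : (n - 1).-tuple 'I_(a + m) |
         avoid_odd_runs (fun c : 'I_(a + m) => c < a) w]|.
Proof.
set P := fun c : 'I_(a + m) => c < a.
have rec_f : lin_rec a m (invert_iter m f0).
  elim: (m) => [|b IH]; last exact: invert_lin_rec.
  by split=> // q q0; rewrite mul0n -f0_rec // addn2.
have cardP : #|P| = a.
  rewrite -sum1_card big_mkcond big_split_ord /=.
  rewrite [X in X + _](eq_bigr (fun=> 1)) => [|i _]; last first.
    by rewrite unfold_in /P /= ltn_ord.
  rewrite [X in _ + X]big1 => [|i _]; last first.
    by rewrite unfold_in /P /= ltnNge leq_addr.
  by rewrite sum1_card card_ord addn0.
have cardPC : #|predC P| = m.
  by apply: (@addnI a); rewrite -{1}cardP cardC card_ord.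
rewrite doubled_countE.
(* Words of length n - 1 are counted, hence the shift by 1. *)
apply: (lin_rec_unique (g := fun q => doubled_count P (q - 1)) rec_f) => //.
split; rewrite ?subnn ?doubled_count0 ?doubled_count1 //.
by move=> [//|q] _; rewrite !subn1 /= doubled_countSS cardP cardPC.
Qed.
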